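(* Let $a\in\mathbb{R}$, $a\neq 0$, and let $x=w(y,z)=f_1(y+az)f_2(z)$ be an affine factorable surface of type 2 in the isotropic space $\mathbb{I}^3$ having constant Gaussian curvature $K_0$. Then it is flat, i.e. $K_0=0$, and for some $c_1,c_2,c_3\in\mathbb{R}$ one of the following occurs: (i) $w(y,z)=c_1f_1(y+az)$, $\frac{\partial f_1}{\partial z}\neq 0$; (ii) $w(y,z)=c_1e^{c_2(y+az)+c_3z}$; (iii) $w(y,z)=c_1(y+az)^{\frac{1}{1-c_2}}z^{\frac{c_2}{c_2-1}}$, $c_2\neq 1$.
   Context: The 3-dimensional isotropic space $\mathbb{I}^3$ is $\mathbb{R}^3$ with affine coordinates $(x,y,z)$ and the degenerate metric $ds^2=dx^2+dy^2$. An affine factorable surface of type 2 is a graph $x=w(y,z)=f_1(y+az)f_2(z)$, where $a\neq 0$ is a real constant and $f_1,f_2$ are smooth real-valued functions of one variable, defined on open intervals $I_1,I_2$; the point $(y,z)$ ranges over $\{(y,z): y+az\in I_1,\ z\in I_2\}$. The surface is assumed admissible (no isotropic tangent planes, i.e. no tangent planes parallel to the $z$-axis), which means $w_z=af_1'f_2+f_1f_2'\neq 0$ everywhere. For an admissible graph $x=w(y,z)$ the (isotropic, or relative) Gaussian curvature is $$K=\frac{w_{yy}w_{zz}-w_{yz}^2}{w_z^4}.$$ In (i), $\frac{\partial f_1}{\partial z}$ denotes the partial derivative of $f_1(y+az)$ with respect to $z$.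
   Formalization: Forms (i)-(iii) are claimed only for non-constant f_1 (w=z is flat, admissible and of none of these forms); (iii) holds up to a translation of (y,z), as w=z^2/(y+az+1) requires, with real powers taken of the absolute values of the bases. *)

(* Defs.v *)
From Stdlib Require Import Reals.
From Coquelicot Require Import Coquelicot.
Open Scope R_scope.

(* The open interval ]l, r[; infinite endpoints are allowed. *)
Definition in_itv (l r : Rbar) (x : R) : Prop := Rbar_lt l x /\ Rbar_lt x r.

(* Functions are total on R, but only their values on ]l, r[ matter:
   all the derivatives below are taken at interior points. *)
Definition smooth_on (l r : Rbar) (f : R -> R) : Prop :=
  forall (n : nat) (x : R), in_itv l r x -> ex_derive_n f n x.

Definition constant_on (l r : Rbar) (f : R -> R) : Prop :=
  exists c : R, forall x : R, in_itv l r x -> f x = c.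

Definition factorable2 (a : R) (f1 f2 : R -> R) (y z : R) : R :=
  f1 (y + a * z) * f2 z.

Definition factorable2_dom (a : R) (l1 r1 l2 r2 : Rbar) (y z : R) : Prop :=
  in_itv l1 r1 (y + a * z) /\ in_itv l2 r2 z.

(* [partial_derive m k w y z] differentiates m times in y and k times in z. *)
Definition admissible (D : R -> R -> Prop) (w : R -> R -> R) : Prop :=
  forall y z : R, D y z -> partial_derive 0 1 w y z <> 0.

Definition gauss_curvature (w : R -> R -> R) (y z : R) : R :=
  (partial_derive 2 0 w y z * partial_derive 0 2 w y z
     - (partial_derive 1 1 w y z) ^ 2)
  / (partial_derive 0 1 w y z) ^ 4.

Definition case_one_factor (a : R) (D : R -> R -> Prop) (f1 : R -> R)
    (w : R -> R -> R) (c1 : R) : Prop :=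
  forall y z : R, D y z ->
    w y z = c1 * f1 (y + a * z) /\
    partial_derive 0 1 (fun y' z' => f1 (y' + a * z')) y z <> 0.

Definition case_exponential (a : R) (D : R -> R -> Prop)
    (w : R -> R -> R) (c1 c2 c3 : R) : Prop :=
  forall y z : R, D y z -> w y z = c1 * exp (c2 * (y + a * z) + c3 * z).

(* The constants of integration of the two factors amount to a translation
   (y0, z0) of the coordinates, up to which the normal form is understood.
   A real power t^r with t < 0 is read as |t|^r: neither base vanishes, so each
   has a constant sign on the connected domain, and any sign goes into c1.
   The nonvanishing of the bases is asserted because [Rpower 0 r] is a
   junk value. *)
Definition case_power (a : R) (D : R -> R -> Prop)
    (w : R -> R -> R) (c1 c2 : R) : Prop :=
  c2 <> 1 /\
  exists y0 z0 : R, forall y z : R, D y z ->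
    (y - y0) + a * (z - z0) <> 0 /\
    z - z0 <> 0 /\
    w y z = c1 * Rpower (Rabs ((y - y0) + a * (z - z0))) (1 / (1 - c2))
               * Rpower (Rabs (z - z0)) (c2 / (c2 - 1)).

(* Main.v *)
Require Import Defs.
From Stdlib Require Import Reals Ranalysis5 Lra Lia Classical.
From Coquelicot Require Import Coquelicot.
Open Scope R_scope.

(** Write [u = y + a z], [f = f1] and [g = f2].  As [(y, z)] ranges over the
    domain, [(u, z)] ranges over the whole product of the two intervals, and
    the mixed terms of the Hessian cancel: the curvature condition becomes

      f f'' g g'' - (f' g')^2 = K0 (a f' g + f g')^4,

    where [w_z = a f' g + f g'] never vanishes
    ([curvature_equation], [partial_derive_01]).

    Flatness ([curvature_constant_zero]).  Suppose [K0 <> 0] and shrink the two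
    intervals so that [f] and [g] do not vanish.  Dividing by [K0 (f g)^4] gives

      A(z) X(u) - B(z) Y(u) = (a f'(u)/f(u) + g'(z)/g(z))^4,

    whose left side has rank at most two as a function of [(u, z)].  If neither
    [f'/f] nor [g'/g] is constant, both take values in arithmetic progression,
    and a matrix of fourth powers [(s_i + t_j)^4] over two such progressions has
    rank at least three ([fourth_powers_not_rank_two]).  If one of them, say
    [f'/f], is a constant [c], the equation at a fixed [z] determines [f^2], so
    [f] is constant, [c = 0], and [K0] must vanish after all
    ([flat_of_exponential_factor]).

    Flat case ([factorable2_flat_cases]).  In [f f'' g g'' = (f' g')^2] with [f']
    and [g'] not identically zero the variables separate:
    [f f'' = k f'^2] and [g g'' = k^-1 g'^2] with [k <> 0].  A zero of [f] would
    then be a zero of [f'] and hence of [w_z], so [f], and likewise [g], never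
    vanishes.  If [k = 1], both logarithmic derivatives are constant and the
    factors are exponentials ([exponential_of_constant_ratio]).  If [k <> 1], then
    [f' |f|^(-k)] is constant, so [f'] never vanishes, and [f / f'] has the
    constant derivative [1 - k], whence [f] is a constant multiple of a power of
    [|u - p|] ([power_of_constant_ratio]), and likewise for [g].
    When [g'] is identically zero, the surface is a multiple of [f], and
    [w_z <> 0] forces [f' <> 0]. *)

(** * Open intervals and intermediate values *)

Lemma in_itv_nonempty (l r : Rbar) : Rbar_lt l r -> exists x : R, in_itv l r x.
Proof.
  intros H.
  destruct l as [l| |]; destruct r as [r| |]; simpl in H; try contradiction.
  - exists ((l + r) / 2); split; simpl; lra.
  - exists (l + 1); split; simpl; [lra | exact I].
  - exists (r - 1); split; simpl; [exact I | lra].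
  - exists 0; split; exact I.
Qed.

Lemma in_itv_locally (l r : Rbar) (x : R) :
  in_itv l r x -> locally x (in_itv l r).
Proof.
  intros [H1 H2]; apply filter_and.
  - exact (open_Rbar_gt l x H1).
  - exact (open_Rbar_lt r x H2).
Qed.

Lemma in_itv_convex (l r : Rbar) (p q x : R) :
  in_itv l r p -> in_itv l r q -> p <= x <= q -> in_itv l r x.
Proof.
  intros [Hp _] [_ Hq] Hx; split.
  - apply Rbar_lt_le_trans with p; [exact Hp | exact (proj1 Hx)].
  - apply Rbar_le_lt_trans with q; [exact (proj2 Hx) | exact Hq].
Qed.

Lemma derive_zero_constant (l r : Rbar) (f : R -> R) :
  (forall x, in_itv l r x -> is_derive f x 0) ->
  forall p q, in_itv l r p -> in_itv l r q -> f p = f q.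
Proof.
  intros Hf.
  assert (Hlt : forall p q, in_itv l r p -> in_itv l r q -> p < q -> f p = f q).
  { intros p q Hp Hq Hpq.
    apply eq_is_derive; [| exact Hpq].
    intros t Ht; apply Hf; exact (in_itv_convex l r p q t Hp Hq Ht). }
  intros p q Hp Hq.
  destruct (Rtotal_order p q) as [H | [H | H]].
  - now apply Hlt.
  - now subst.
  - symmetry; now apply Hlt.
Qed.

Lemma is_derive_nonzero_nbhd (l r : Rbar) (f : R -> R) (d x0 : R) :
  in_itv l r x0 -> is_derive f x0 d -> f x0 <> 0 ->
  exists p q : R, p < q /\
    forall x, in_itv p q x -> in_itv l r x /\ f x <> 0.
Proof.
  intros Hx Hd Hn.
  assert (Hc : continuous f x0).
  { apply (ex_derive_continuous (V := R_NormedModule)); now exists d. }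
  assert (Hloc : locally x0 (fun x => in_itv l r x /\ f x <> 0)).
  { apply filter_and; [now apply in_itv_locally |].
    apply (Hc (fun y => y <> 0)); exact (open_neq 0 (f x0) Hn). }
  destruct Hloc as [eps Heps].
  exists (x0 - eps), (x0 + eps); split; [generalize (cond_pos eps); lra |].
  intros x [H1 H2]; simpl in H1, H2; apply Heps.
  apply Rabs_def1; unfold minus, plus, opp; simpl; lra.
Qed.

Lemma ivt_strict (f : R -> R) (p q v : R) :
  p < q -> (forall x, p <= x <= q -> continuous f x) ->
  f p < v < f q \/ f q < v < f p ->
  {x : R | p <= x <= q /\ f x = v}.
Proof.
  intros Hpq Hc Hv.
  destruct (Rlt_dec (f p) v) as [Hlt | Hge].
  - destruct (IVT_interv (fun x => f x - v) p q) as [x [Hx Hfx]]; try lra.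
    + intros x Hx; apply continuity_pt_minus.
      * apply continuity_pt_filterlim, Hc, Hx.
      * apply continuity_pt_const; now intros ? ?.
    + exists x; split; [exact Hx | lra].
  - destruct (IVT_interv (fun x => v - f x) p q) as [x [Hx Hfx]]; try lra.
    + intros x Hx; apply continuity_pt_minus.
      * apply continuity_pt_const; now intros ? ?.
      * apply continuity_pt_filterlim, Hc, Hx.
    + exists x; split; [exact Hx | lra].
Qed.

(** Three equidistant values are needed of one logarithmic derivative and five of
    the other. *)
Lemma constant_or_arithmetic_values (l r : Rbar) (f : R -> R) :
  (forall x, in_itv l r x -> continuous f x) ->
  (forall p q, in_itv l r p -> in_itv l r q -> f p = f q) \/
  exists (x : nat -> R) (s d : R), d <> 0 /\
    forall j, (j <= 4)%nat -> in_itv l r (x j) /\ f (x j) = s + INR j * d.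
Proof.
  intros Hc.
  destruct (classic (exists p q, in_itv l r p /\ in_itv l r q /\ p < q /\ f p <> f q))
    as [[p [q [Hp [Hq [Hpq Hne]]]]] | Hno].
  - right.
    (* A sixth of [f q - f p] as step keeps the five values strictly between
       [f p] and [f q]; the index is capped at 4 so that the points form a
       total sequence. *)
    set (d := (f q - f p) / 6).
    assert (Hd : d <> 0) by (unfold d; lra).
    assert (Hx : forall j, {x : R | p <= x <= q /\
                                    f x = f p + d + INR (min j 4) * d}).
    { intros j; apply ivt_strict; [exact Hpq | |].
      - intros x Hx; apply Hc; exact (in_itv_convex l r p q x Hp Hq Hx).
      - assert (H0 : 0 <= INR (min j 4) <= 4).
        { split; [apply pos_INR |].
          replace 4 with (INR 4) by (simpl; ring); apply le_INR; lia. }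
        destruct (Rlt_dec 0 d) as [Hd0 | Hd0]; [left | right];
          replace (f q) with (f p + 6 * d) by (unfold d; field); nra. }
    exists (fun j => proj1_sig (Hx j)), (f p + d), d.
    split; [exact Hd |].
    intros j Hj; destruct (Hx j) as [x [Hxpq Hfx]]; simpl; split.
    + exact (in_itv_convex l r p q x Hp Hq Hxpq).
    + rewrite Hfx, Nat.min_l by exact Hj; reflexivity.
  - left.
    assert (Hlt : forall p q, in_itv l r p -> in_itv l r q -> p < q -> f p = f q).
    { intros p q Hp Hq Hpq; apply NNPP; intros Hne.
      apply Hno; exists p, q; auto. }
    intros p q Hp Hq; destruct (Rtotal_order p q) as [H | [H | H]].
    + now apply Hlt.
    + now subst.
    + symmetry; now apply Hlt.
Qed.

(** * Matrices of fourth powers *)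

Lemma orthogonal_vector3 (X Y : nat -> R) :
  exists c0 c1 c2 : R, ~ (c0 = 0 /\ c1 = 0 /\ c2 = 0) /\
    c0 * X 0%nat + c1 * X 1%nat + c2 * X 2%nat = 0 /\
    c0 * Y 0%nat + c1 * Y 1%nat + c2 * Y 2%nat = 0.
Proof.
  set (x0 := X 0%nat); set (x1 := X 1%nat); set (x2 := X 2%nat).
  set (y0 := Y 0%nat); set (y1 := Y 1%nat); set (y2 := Y 2%nat).
  clearbody x0 x1 x2 y0 y1 y2; clear X Y.
  destruct (classic (x1 * y2 - x2 * y1 = 0 /\ x2 * y0 - x0 * y2 = 0 /\
                     x0 * y1 - x1 * y0 = 0)) as [[E0 [E1 E2]] | Hne].
  2: { exists (x1 * y2 - x2 * y1), (x2 * y0 - x0 * y2), (x0 * y1 - x1 * y0).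
       split; [exact Hne | split; ring]. }
  (* X and Y are parallel: a vector orthogonal to a nonzero one of them works. *)
  destruct (Req_dec x0 0) as [X0 | X0].
  2: { exists x1, (- x0), 0; repeat split; [intros [_ [H _]]; lra | ring | lra]. }
  destruct (Req_dec x1 0) as [X1 | X1].
  2: { exists x1, (- x0), 0; repeat split; [intros [H _]; lra | ring | lra]. }
  destruct (Req_dec x2 0) as [X2 | X2].
  2: { exists x2, 0, (- x0); repeat split; [intros [H _]; lra | ring | lra]. }
  subst.
  destruct (Req_dec y0 0) as [Y0 | Y0].
  2: { exists y1, (- y0), 0; repeat split; [intros [_ [H _]]; lra | ring | ring]. }
  exists 1, 0, 0; subst; repeat split; [intros [H _]; lra | ring | ring].
Qed.

(** A vector [c] orthogonal to [X] and [Y] gives a polynomial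
    [P(v) = c0 v^4 + c1 (v + d)^4 + c2 (v + 2 d)^4] vanishing at five equidistant
    points.  Its fourth, third and second differences yield in turn
    [c0 + c1 + c2 = 0], [c1 + 2 c2 = 0] and [c2 = 0]. *)
Lemma fourth_powers_not_rank_two (A X B Y : nat -> R) (s d t h : R) :
  d <> 0 -> h <> 0 ->
  ~ (forall i j, (i <= 2)%nat -> (j <= 4)%nat ->
       A j * X i - B j * Y i = ((s + INR i * d) + (t + INR j * h)) ^ 4).
Proof.
  intros Hd Hh H.
  destruct (orthogonal_vector3 X Y) as [c0 [c1 [c2 [Hc [HX HY]]]]].
  apply Hc.
  set (v := s + t).
  assert (HP : forall j, (j <= 4)%nat ->
    c0 * (v + INR j * h) ^ 4 + c1 * (v + INR j * h + d) ^ 4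
      + c2 * (v + INR j * h + 2 * d) ^ 4 = 0).
  { intros j Hj.
    assert (H0 := H 0%nat j ltac:(lia) Hj).
    assert (H1 := H 1%nat j ltac:(lia) Hj).
    assert (H2 := H 2%nat j ltac:(lia) Hj).
    simpl (INR 0) in H0; simpl (INR 1) in H1.
    replace (INR 2) with 2 in H2 by (simpl; ring).
    replace (v + INR j * h) with (s + 0 * d + (t + INR j * h)) at 1 by (unfold v; ring).
    replace (v + INR j * h + d) with (s + 1 * d + (t + INR j * h)) by (unfold v; ring).
    replace (v + INR j * h + 2 * d) with (s + 2 * d + (t + INR j * h)) by (unfold v; ring).
    rewrite <- H0, <- H1, <- H2.
    transitivity (A j * (c0 * X 0%nat + c1 * X 1%nat + c2 * X 2%nat)
                  - B j * (c0 * Y 0%nat + c1 * Y 1%nat + c2 * Y 2%nat)); [ring |].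
    rewrite HX, HY; ring. }
  assert (P0 := HP 0%nat ltac:(lia)). assert (P1 := HP 1%nat ltac:(lia)).
  assert (P2 := HP 2%nat ltac:(lia)). assert (P3 := HP 3%nat ltac:(lia)).
  assert (P4 := HP 4%nat ltac:(lia)).
  clear HP H HX HY Hc. simpl INR in *.
  assert (S0 : c0 + c1 + c2 = 0).
  { apply (Rmult_eq_reg_l (24 * h ^ 4));
      [| apply Rmult_integral_contrapositive; split; [lra | now apply pow_nonzero]].
    rewrite Rmult_0_r.
    match type of P0 with ?a = _ => match type of P1 with ?b = _ =>
    match type of P2 with ?c = _ => match type of P3 with ?e = _ =>
    match type of P4 with ?f = _ =>
     transitivity (f - 4 * e + 6 * c - 4 * b + a); [ring | lra] end end end end end. }
  assert (Ec0 : c0 = - c1 - c2) by lra. subst c0.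
  assert (S1 : c1 + 2 * c2 = 0).
  { apply (Rmult_eq_reg_l (24 * h ^ 3 * d));
      [| repeat apply Rmult_integral_contrapositive_currified;
         try lra; now apply pow_nonzero].
    rewrite Rmult_0_r.
    match type of P0 with ?a = _ => match type of P1 with ?b = _ =>
    match type of P2 with ?c = _ => match type of P3 with ?e = _ =>
     transitivity (e - 3 * c + 3 * b - a); [ring | lra] end end end end. }
  assert (Ec1 : c1 = - 2 * c2) by lra. subst c1.
  assert (S2 : c2 = 0).
  { apply (Rmult_eq_reg_l (24 * h ^ 2 * d ^ 2));
      [| repeat apply Rmult_integral_contrapositive_currified;
         try lra; now apply pow_nonzero].
    rewrite Rmult_0_r.
    match type of P0 with ?a = _ => match type of P1 with ?b = _ =>
    match type of P2 with ?c = _ =>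
     transitivity (c - 2 * b + a); [ring | lra] end end end. }
  lra.
Qed.

(** * Vanishing of the curvature constant *)

(** [f'] and [f''] are the first two derivatives of [f] on the open interval
    from [l] to [r]; no condition is put on the values outside. *)
Definition derivatives_on (l r : Rbar) (f f' f'' : R -> R) : Prop :=
  forall x, in_itv l r x -> is_derive f x (f' x) /\ is_derive f' x (f'' x).

Lemma derivatives_on_sub (l r p q : Rbar) (f f' f'' : R -> R) :
  (forall x, in_itv p q x -> in_itv l r x) ->
  derivatives_on l r f f' f'' -> derivatives_on p q f f' f''.
Proof. intros Hs Hf x Hx; apply Hf, Hs, Hx. Qed.

Lemma derivative_of_constant (l r : Rbar) (f f' f'' : R -> R) (c : R) :
  derivatives_on l r f f' f'' ->
  (forall x, in_itv l r x -> f x = c) ->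
  forall x, in_itv l r x -> f' x = 0.
Proof.
  intros Hf Hc x Hx.
  rewrite <- (is_derive_unique _ _ _ (proj1 (Hf x Hx))).
  rewrite (Derive_ext_loc f (fun _ => c)); [apply Derive_const |].
  generalize (in_itv_locally l r x Hx); apply filter_imp; exact Hc.
Qed.

Lemma second_derivative_of_exponential (l r : Rbar) (f f' f'' : R -> R) (c : R) :
  derivatives_on l r f f' f'' ->
  (forall x, in_itv l r x -> f' x = c * f x) ->
  forall x, in_itv l r x -> f'' x = c * f' x.
Proof.
  intros Hf Hc x Hx.
  assert (H1 := is_derive_unique _ _ _ (proj2 (Hf x Hx))).
  rewrite <- H1.
  apply is_derive_unique.
  apply (is_derive_ext_loc (fun x => c * f x)).
  - generalize (in_itv_locally l r x Hx); apply filter_imp.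
    intros y Hy; symmetry; now apply Hc.
  - apply is_derive_scal; apply Hf, Hx.
Qed.

(** The numbers [g], [g'], [g''] are the values of the other factor and of its
    derivatives at one point.  With two coefficients [a] and [b] the equation is
    symmetric in the two factors, so that the lemma applies to either. *)
Lemma flat_of_exponential_factor (l r : Rbar) (f f' f'' : R -> R)
    (c a b K g g' g'' : R) :
  Rbar_lt l r -> derivatives_on l r f f' f'' ->
  (forall x, in_itv l r x -> f' x = c * f x) ->
  (forall x, in_itv l r x -> a * f' x * g + b * f x * g' <> 0) ->
  (forall x, in_itv l r x ->
     f x * f'' x * (g * g'') - (f' x * g') ^ 2
       = K * (a * f' x * g + b * f x * g') ^ 4) ->
  K = 0.
Proof.
  intros Hlr Hf Hc Hw HK; apply NNPP; intros HK0.
  destruct (in_itv_nonempty l r Hlr) as [x0 Hx0].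
  assert (Hc2 := second_derivative_of_exponential l r f f' f'' c Hf Hc).
  set (m := a * c * g + b * g').
  set (N := c ^ 2 * (g * g'' - g' ^ 2)).
  assert (Hfm : forall x, in_itv l r x -> f x <> 0 /\ m <> 0).
  { intros x Hx.
    assert (H : f x * m <> 0).
    { replace (f x * m) with (a * f' x * g + b * f x * g'); [now apply Hw |].
      rewrite Hc by exact Hx; unfold m; ring. }
    split; intros E; apply H; rewrite E; ring. }
  assert (Hm : K * m ^ 4 <> 0).
  { apply Rmult_integral_contrapositive_currified; [exact HK0 |].
    apply pow_nonzero, (Hfm x0 Hx0). }
  (* The equation prescribes a value of [f ^ 2] independent of the point, so
     [f] has derivative zero. *)
  assert (Hsq : forall x, in_itv l r x -> f x ^ 2 = N / (K * m ^ 4)).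
  { intros x Hx.
    assert (H := HK x Hx).
    rewrite Hc2, Hc in H by exact Hx.
    assert (Hfx := proj1 (Hfm x Hx)).
    apply (Rmult_eq_reg_l (f x ^ 2 * (K * m ^ 4))).
    - transitivity (K * (a * (c * f x) * g + b * f x * g') ^ 4);
        [unfold m; ring |].
      rewrite <- H. transitivity (f x ^ 2 * N); [unfold N; ring |].
      field. split; [|exact HK0]. intros E; apply Hm; rewrite E; ring.
    - apply Rmult_integral_contrapositive_currified; [now apply pow_nonzero | exact Hm]. }
  assert (Hff : 2 * f x0 * f' x0 = 0).
  { rewrite <- (Derive_const (N / (K * m ^ 4)) x0).
    symmetry; apply is_derive_unique.
    apply (is_derive_ext_loc (fun x : R => f x * f x)).
    - generalize (in_itv_locally l r x0 Hx0); apply filter_imp.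
      intros y Hy; change (f y * f y = N / (K * m ^ 4)); rewrite <- (Hsq y Hy); ring.
    - replace (2 * f x0 * f' x0) with (f' x0 * f x0 + f x0 * f' x0) by ring.
      apply (is_derive_mult f f); try apply Hf, Hx0. intros; apply Rmult_comm. }
  assert (Hf0 := proj1 (Hfm x0 Hx0)).
  rewrite (Hc x0 Hx0) in Hff.
  assert (Hc0 : c = 0).
  { apply (Rmult_eq_reg_l (2 * f x0 ^ 2)).
    - rewrite Rmult_0_r, <- Hff; ring.
    - apply Rmult_integral_contrapositive_currified; [lra | now apply pow_nonzero]. }
  apply (pow_nonzero (f x0) 2 Hf0).
  rewrite (Hsq x0 Hx0); unfold N; rewrite Hc0; field.
  split; [| exact HK0]. intros E; apply Hm; rewrite Hc0 in *; rewrite E; ring.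
Qed.

Lemma log_derivative_continuous (l r : Rbar) (f f' f'' : R -> R) :
  derivatives_on l r f f' f'' -> (forall x, in_itv l r x -> f x <> 0) ->
  forall x, in_itv l r x -> continuous (fun x => f' x / f x) x.
Proof.
  intros Hf Hn x Hx.
  apply (ex_derive_continuous (V := R_NormedModule)).
  apply ex_derive_div; [| | now apply Hn].
  - exists (f'' x); apply Hf, Hx.
  - exists (f' x); apply Hf, Hx.
Qed.

Lemma curvature_constant_zero (l1 r1 l2 r2 : Rbar) (f f' f'' g g' g'' : R -> R)
    (a K : R) :
  a <> 0 -> Rbar_lt l1 r1 -> Rbar_lt l2 r2 ->
  derivatives_on l1 r1 f f' f'' -> derivatives_on l2 r2 g g' g'' ->
  (forall u z, in_itv l1 r1 u -> in_itv l2 r2 z ->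
     a * f' u * g z + f u * g' z <> 0) ->
  (forall u z, in_itv l1 r1 u -> in_itv l2 r2 z ->
     f u * f'' u * (g z * g'' z) - (f' u * g' z) ^ 2
       = K * (a * f' u * g z + f u * g' z) ^ 4) ->
  K = 0.
Proof.
  intros Ha HI1 HI2 Hf Hg Hw HK.
  (* A factor vanishing identically would make w_z vanish. *)
  assert (Hfn : exists u, in_itv l1 r1 u /\ f u <> 0).
  { apply NNPP; intros Hno.
    destruct (in_itv_nonempty _ _ HI1) as [u Hu].
    destruct (in_itv_nonempty _ _ HI2) as [z Hz].
    assert (H0 : forall x, in_itv l1 r1 x -> f x = 0).
    { intros x Hx; apply NNPP; intros E; apply Hno; now exists x. }
    apply (Hw u z Hu Hz).
    rewrite (derivative_of_constant _ _ _ _ _ _ Hf H0 u Hu), (H0 u Hu); ring. }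
  assert (Hgn : exists z, in_itv l2 r2 z /\ g z <> 0).
  { apply NNPP; intros Hno.
    destruct (in_itv_nonempty _ _ HI1) as [u Hu].
    destruct (in_itv_nonempty _ _ HI2) as [z Hz].
    assert (H0 : forall x, in_itv l2 r2 x -> g x = 0).
    { intros x Hx; apply NNPP; intros E; apply Hno; now exists x. }
    apply (Hw u z Hu Hz).
    rewrite (derivative_of_constant _ _ _ _ _ _ Hg H0 z Hz), (H0 z Hz); ring. }
  destruct Hfn as [u0 [Hu0 Hfu0]]; destruct Hgn as [z0 [Hz0 Hgz0]].
  destruct (is_derive_nonzero_nbhd _ _ _ _ _ Hu0 (proj1 (Hf u0 Hu0)) Hfu0)
    as [p1 [q1 [Hpq1 HJ1]]].
  destruct (is_derive_nonzero_nbhd _ _ _ _ _ Hz0 (proj1 (Hg z0 Hz0)) Hgz0)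
    as [p2 [q2 [Hpq2 HJ2]]].
  assert (Hf1 : derivatives_on p1 q1 f f' f'').
  { apply (derivatives_on_sub l1 r1); [intros x Hx; now apply HJ1 | exact Hf]. }
  assert (Hg1 : derivatives_on p2 q2 g g' g'').
  { apply (derivatives_on_sub l2 r2); [intros x Hx; now apply HJ2 | exact Hg]. }
  assert (Hcf := log_derivative_continuous _ _ _ _ _ Hf1 (fun x Hx => proj2 (HJ1 x Hx))).
  assert (Hcg := log_derivative_continuous _ _ _ _ _ Hg1 (fun x Hx => proj2 (HJ2 x Hx))).
  destruct (constant_or_arithmetic_values _ _ _ Hcf) as [Hfc | [x [s [d [Hd Hx]]]]].
  { destruct (in_itv_nonempty p1 q1 Hpq1) as [u1 Hu1].
    apply (flat_of_exponential_factor p1 q1 f f' f'' (f' u1 / f u1) a 1 K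
             (g z0) (g' z0) (g'' z0)); try assumption.
    - intros u Hu; rewrite <- (Hfc u u1 Hu Hu1); field; now apply HJ1.
    - intros u Hu; rewrite Rmult_1_l; apply Hw; [now apply HJ1 | assumption].
    - intros u Hu; rewrite Rmult_1_l; apply HK; [now apply HJ1 | assumption]. }
  destruct (constant_or_arithmetic_values _ _ _ Hcg) as [Hgc | [y [t [h [Hh Hy]]]]].
  { destruct (in_itv_nonempty p2 q2 Hpq2) as [z1 Hz1].
    apply (flat_of_exponential_factor p2 q2 g g' g'' (g' z1 / g z1) 1 a K
             (f u0) (f' u0) (f'' u0)); try assumption.
    - intros z Hz; rewrite <- (Hgc z z1 Hz Hz1); field; now apply HJ2.
    - intros z Hz.
      replace (1 * g' z * f u0 + a * g z * f' u0)
        with (a * f' u0 * g z + f u0 * g' z) by ring.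
      apply Hw; [assumption | now apply HJ2].
    - intros z Hz.
      replace (1 * g' z * f u0 + a * g z * f' u0)
        with (a * f' u0 * g z + f u0 * g' z) by ring.
      rewrite <- HK; [ring | assumption | now apply HJ2]. }
  apply NNPP; intros HK0; exfalso.
  (* Divided by K (f g) ^ 4, the equation has rank at most two in (u, z). *)
  apply (fourth_powers_not_rank_two
           (fun j => g'' (y j) / g (y j) ^ 3) (fun i => f'' (x i) / (K * f (x i) ^ 3))
           (fun j => (g' (y j)) ^ 2 / g (y j) ^ 4)
           (fun i => (f' (x i)) ^ 2 / (K * f (x i) ^ 4))
           (a * s) (a * d) t h).
  - now apply Rmult_integral_contrapositive_currified.
  - exact Hh.
  - intros i j Hi Hj.
    destruct (Hx i ltac:(lia)) as [Hxi Exi]; destruct (Hy j Hj) as [Hyj Eyj].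
    destruct (HJ1 _ Hxi) as [Ixi Nxi]; destruct (HJ2 _ Hyj) as [Iyj Nyj].
    replace (a * s + INR i * (a * d)) with (a * (s + INR i * d)) by ring.
    rewrite <- Exi, <- Eyj.
    transitivity ((f (x i) * f'' (x i) * (g (y j) * g'' (y j)) - (f' (x i) * g' (y j)) ^ 2)
                  / (K * f (x i) ^ 4 * g (y j) ^ 4)).
    + field; repeat split; assumption.
    + rewrite (HK _ _ Ixi Iyj); field; repeat split; assumption.
Qed.

(** * Functions with a constant ratio f f'' / f'^2 *)

Lemma is_derive_Rpower_Rabs (f : R -> R) (x d s : R) :
  is_derive f x d -> f x <> 0 ->
  is_derive (fun y => Rpower (Rabs (f y)) s) x
    (s * d / f x * Rpower (Rabs (f x)) s).
Proof.
  intros Hd Hn.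
  assert (Hp : 0 < Rabs (f x)) by now apply Rabs_pos_lt.
  assert (Habs := is_derive_Rabs f x d Hd Hn).
  evar_last.
  - unfold Rpower.
    apply (is_derive_comp exp (fun y => s * ln (Rabs (f y)))).
    + apply is_derive_exp.
    + apply is_derive_scal.
      apply (is_derive_comp ln (fun y => Rabs (f y))); [| exact Habs].
      now apply is_derive_ln.
  - unfold scal; simpl; unfold mult; simpl.
    fold (Rpower (Rabs (f x)) s).
    destruct (Rdichotomy _ _ Hn) as [Hlt | Hgt].
    + rewrite (sign_eq_m1 (f x) Hlt), (Rabs_left (f x) Hlt); field; exact Hn.
    + rewrite (sign_eq_1 (f x) Hgt), (Rabs_right (f x)) by lra; field; exact Hn.
Qed.

Lemma is_derive_mult_R (f g : R -> R) (x df dg : R) :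
  is_derive f x df -> is_derive g x dg ->
  is_derive (fun y => f y * g y) x (df * g x + f x * dg).
Proof. intros Hf Hg; apply (is_derive_mult f g x df dg Hf Hg); exact Rmult_comm. Qed.

Lemma exponential_of_constant_ratio (l r : Rbar) (f f' f'' : R -> R) :
  Rbar_lt l r -> derivatives_on l r f f' f'' ->
  (forall x, in_itv l r x -> f x <> 0) ->
  (forall x, in_itv l r x -> f x * f'' x = (f' x) ^ 2) ->
  exists C c, forall x, in_itv l r x -> f x = C * exp (c * x).
Proof.
  intros Hlr Hf Hn Hk.
  destruct (in_itv_nonempty l r Hlr) as [x0 Hx0].
  set (c := f' x0 / f x0).
  assert (Hc : forall x, in_itv l r x -> f' x = c * f x).
  { intros x Hx.
    assert (E : f' x / f x = c).
    { apply (derive_zero_constant l r (fun y => f' y / f y)); try assumption.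
      intros y Hy; evar_last.
      - apply is_derive_div; [exact (proj2 (Hf y Hy)) | exact (proj1 (Hf y Hy)) | now apply Hn].
      - transitivity ((f y * f'' y - (f' y) ^ 2) / (f y) ^ 2).
        + field; now apply Hn.
        + rewrite Hk by exact Hy; unfold Rdiv; ring. }
    rewrite <- E; field; now apply Hn. }
  exists (f x0 * exp (- c * x0)), c; intros x Hx.
  assert (E : f x * exp (- c * x) = f x0 * exp (- c * x0)).
  { apply (derive_zero_constant l r (fun y => f y * exp (- c * y))); try assumption.
    intros y Hy; evar_last.
    - apply is_derive_mult_R; [exact (proj1 (Hf y Hy)) |].
      apply (is_derive_comp exp (fun y => - c * y)); [apply is_derive_exp |].
      apply is_derive_scal, is_derive_id.
    - unfold scal, one; simpl; unfold mult; simpl; rewrite Hc by exact Hy; ring. }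
  rewrite <- E, Rmult_assoc, <- exp_plus.
  replace (- c * x + c * x) with 0 by ring; rewrite exp_0; ring.
Qed.

Lemma power_of_constant_ratio (l r : Rbar) (f f' f'' : R -> R) (k : R) :
  derivatives_on l r f f' f'' ->
  (forall x, in_itv l r x -> f x <> 0) ->
  (forall x, in_itv l r x -> f x * f'' x = k * (f' x) ^ 2) ->
  (exists x, in_itv l r x /\ f' x <> 0) -> k <> 1 ->
  exists C p, forall x, in_itv l r x ->
    x - p <> 0 /\ f x = C * Rpower (Rabs (x - p)) (1 / (1 - k)).
Proof.
  intros Hf Hn Hk [x0 [Hx0 Hd0]] Hk1.
  assert (Hpow : forall t s, Rpower t s <> 0).
  { intros t s; apply Rgt_not_eq, exp_pos. }
  (* [f' |f|^(-k)] is a nonzero constant. *)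
  assert (Hd : forall x, in_itv l r x -> f' x <> 0).
  { intros x Hx E.
    assert (H : f' x * Rpower (Rabs (f x)) (- k) = f' x0 * Rpower (Rabs (f x0)) (- k)).
    { apply (derive_zero_constant l r (fun y => f' y * Rpower (Rabs (f y)) (- k)));
        try assumption.
      intros y Hy; assert (Hny := Hn y Hy); evar_last.
      - apply is_derive_mult_R; [exact (proj2 (Hf y Hy)) |].
        apply is_derive_Rpower_Rabs; [exact (proj1 (Hf y Hy)) | exact Hny].
      - transitivity ((f y * f'' y - k * (f' y) ^ 2) / f y * Rpower (Rabs (f y)) (- k)).
        + field; exact Hny.
        + rewrite Hk by exact Hy; unfold Rdiv; ring. }
    rewrite E, Rmult_0_l in H; symmetry in H.
    apply Rmult_integral in H; destruct H as [H | H]; [now apply Hd0 | now apply (Hpow _ _ H)]. }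
  (* [f / f'] has derivative [1 - k], so it is [(1 - k) (x - p)] for some [p]. *)
  set (p := x0 - f x0 / ((1 - k) * f' x0)).
  assert (Hk2 : 1 - k <> 0) by lra.
  assert (Hp : forall x, in_itv l r x -> x - p = f x / ((1 - k) * f' x)).
  { intros x Hx.
    assert (H : x - f x / ((1 - k) * f' x) = p).
    { apply (derive_zero_constant l r (fun y => y - f y / ((1 - k) * f' y)));
        try assumption.
      intros y Hy; assert (Hny := Hd y Hy); evar_last.
      - apply (is_derive_minus (V := R_NormedModule) (fun y => y)
                 (fun y => f y / ((1 - k) * f' y))); [apply is_derive_id |].
        apply is_derive_div;
          [exact (proj1 (Hf y Hy)) | apply is_derive_scal; exact (proj2 (Hf y Hy)) |].
        now apply Rmult_integral_contrapositive_currified.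
      - unfold minus, plus, opp, one; simpl.
        transitivity ((f y * f'' y - k * (f' y) ^ 2) / ((1 - k) * (f' y) ^ 2)).
        + field; split; assumption.
        + rewrite Hk by exact Hy; unfold Rdiv; ring. }
    rewrite <- H; ring. }
  assert (Hp0 : forall x, in_itv l r x -> x - p <> 0).
  { intros x Hx; rewrite Hp by exact Hx; unfold Rdiv.
    apply Rmult_integral_contrapositive_currified; [now apply Hn |].
    apply Rinv_neq_0_compat, Rmult_integral_contrapositive_currified; auto. }
  set (s := 1 / (1 - k)).
  exists (f x0 * Rpower (Rabs (x0 - p)) (- s)), p; intros x Hx.
  split; [now apply Hp0 |].
  assert (E : f x * Rpower (Rabs (x - p)) (- s) = f x0 * Rpower (Rabs (x0 - p)) (- s)).
  { apply (derive_zero_constant l r (fun y => f y * Rpower (Rabs (y - p)) (- s)));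
      try assumption.
    intros y Hy; evar_last.
    - apply is_derive_mult_R; [exact (proj1 (Hf y Hy)) |].
      apply (is_derive_Rpower_Rabs (fun y => y - p) y 1); [| now apply Hp0].
      auto_derive; [exact I | ring].
    - cbv beta; generalize (Rpower (Rabs (y - p)) (- s)); intros P.
      rewrite (Hp y Hy); unfold s; field; repeat split; auto. }
  rewrite <- E, Rmult_assoc, <- Rpower_plus.
  replace (- s + s) with 0 by ring.
  rewrite Rpower_O; [ring | apply Rabs_pos_lt; now apply Hp0].
Qed.

Lemma smooth_derivatives_on (l r : Rbar) (f : R -> R) :
  smooth_on l r f -> derivatives_on l r f (Derive f) (Derive (Derive f)).
Proof.
  intros Hf x Hx; split; apply Derive_correct.
  - exact (Hf 1%nat x Hx).
  - exact (Hf 2%nat x Hx).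
Qed.

(** * Partial derivatives of a factorable graph *)

Lemma is_derive_shift_z (f : R -> R) (t z d : R) (a : R) :
  is_derive f (t + a * z) d -> is_derive (fun z' => f (t + a * z')) z (a * d).
Proof.
  intros Hd; apply (is_derive_comp f (fun z' => t + a * z')); [exact Hd |].
  auto_derive; [exact I | ring].
Qed.

Lemma is_derive_shift_y (f : R -> R) (y c d : R) :
  is_derive f (y + c) d -> is_derive (fun y' => f (y' + c)) y d.
Proof.
  intros Hd; evar_last.
  - apply (is_derive_comp f (fun y' => y' + c)); [exact Hd |].
    auto_derive; [exact I | reflexivity].
  - unfold scal; simpl; unfold mult; simpl; ring.
Qed.

Section PartialDerivatives.

Variables (a : R) (l1 r1 l2 r2 : Rbar) (f f' f'' g g' g'' : R -> R).
Hypothesis Hf : derivatives_on l1 r1 f f' f''.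
Hypothesis Hg : derivatives_on l2 r2 g g' g''.

Let w := factorable2 a f g.
Let D := factorable2_dom a l1 r1 l2 r2.

Lemma domain_locally_y (y z : R) : D y z -> locally y (fun y' => D y' z).
Proof.
  intros [Hu Hz]; apply filter_and; [| now apply filter_forall].
  assert (Hc : continuous (fun y' => y' + a * z) y).
  { apply (ex_derive_continuous (V := R_NormedModule)); now auto_derive. }
  exact (Hc _ (in_itv_locally _ _ _ Hu)).
Qed.

Lemma domain_locally_z (y z : R) : D y z -> locally z (fun z' => D y z').
Proof.
  intros [Hu Hz]; apply filter_and; [| now apply in_itv_locally].
  assert (Hc : continuous (fun z' => y + a * z') z).
  { apply (ex_derive_continuous (V := R_NormedModule)); now auto_derive. }
  exact (Hc _ (in_itv_locally _ _ _ Hu)).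
Qed.

Lemma partial_y (y z : R) : D y z ->
  is_derive (fun y' => w y' z) y (f' (y + a * z) * g z).
Proof.
  intros [Hu Hz]; unfold w, factorable2; evar_last.
  - apply is_derive_mult_R; [apply is_derive_shift_y; exact (proj1 (Hf _ Hu)) |].
    apply is_derive_const.
  - unfold zero; simpl; ring.
Qed.

Lemma partial_z (y z : R) : D y z ->
  is_derive (fun z' => w y z') z (a * f' (y + a * z) * g z + f (y + a * z) * g' z).
Proof.
  intros [Hu Hz]; unfold w, factorable2.
  apply (is_derive_mult_R (fun z' => f (y + a * z')) g).
  - apply is_derive_shift_z; exact (proj1 (Hf _ Hu)).
  - exact (proj1 (Hg _ Hz)).
Qed.

Lemma partial_derive_01 (y z : R) : D y z ->
  partial_derive 0 1 w y z = a * f' (y + a * z) * g z + f (y + a * z) * g' z.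
Proof. intros Hyz; apply is_derive_unique; now apply partial_z. Qed.

Lemma partial_derive_20 (y z : R) : D y z ->
  partial_derive 2 0 w y z = f'' (y + a * z) * g z.
Proof.
  intros Hyz; change (Derive (Derive (fun y' => w y' z)) y = f'' (y + a * z) * g z).
  apply is_derive_unique.
  apply (is_derive_ext_loc (fun y' => f' (y' + a * z) * g z)).
  - generalize (domain_locally_y y z Hyz); apply filter_imp.
    intros t Ht; symmetry; apply is_derive_unique; now apply partial_y.
  - destruct Hyz as [Hu Hz]; evar_last.
    + apply is_derive_mult_R; [apply is_derive_shift_y; exact (proj2 (Hf _ Hu)) |].
      apply is_derive_const.
    + unfold zero; simpl; ring.
Qed.

Lemma partial_derive_11 (y z : R) : D y z ->
  partial_derive 1 1 w y z = a * f'' (y + a * z) * g z + f' (y + a * z) * g' z.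
Proof.
  intros Hyz; change (Derive (fun y' => Derive (fun z' => w y' z') z) y
                      = a * f'' (y + a * z) * g z + f' (y + a * z) * g' z).
  apply is_derive_unique.
  apply (is_derive_ext_loc
           (fun y' => f' (y' + a * z) * (a * g z) + f (y' + a * z) * g' z)).
  - generalize (domain_locally_y y z Hyz); apply filter_imp.
    intros t Ht; symmetry; evar_last.
    + apply is_derive_unique; now apply partial_z.
    + ring.
  - destruct Hyz as [Hu Hz]; evar_last.
    + apply (is_derive_plus (V := R_NormedModule)); apply is_derive_mult_R;
        [| apply is_derive_const | | apply is_derive_const].
      * apply is_derive_shift_y; exact (proj2 (Hf _ Hu)).
      * apply is_derive_shift_y; exact (proj1 (Hf _ Hu)).
    + unfold plus, zero; simpl; ring.
Qed.

Lemma partial_derive_02 (y z : R) : D y z ->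
  partial_derive 0 2 w y z
  = a ^ 2 * f'' (y + a * z) * g z + 2 * a * f' (y + a * z) * g' z
    + f (y + a * z) * g'' z.
Proof.
  intros Hyz; change (Derive (Derive (fun z' => w y z')) z
    = a ^ 2 * f'' (y + a * z) * g z + 2 * a * f' (y + a * z) * g' z
    + f (y + a * z) * g'' z).
  apply is_derive_unique.
  apply (is_derive_ext_loc
           (fun z' => f' (y + a * z') * (a * g z') + f (y + a * z') * g' z')).
  - generalize (domain_locally_z y z Hyz); apply filter_imp.
    intros t Ht; symmetry; evar_last.
    + apply is_derive_unique; now apply partial_z.
    + ring.
  - destruct Hyz as [Hu Hz]; evar_last.
    + apply (is_derive_plus (V := R_NormedModule)); apply is_derive_mult_R.
      * apply is_derive_shift_z; exact (proj2 (Hf _ Hu)).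
      * apply is_derive_scal; exact (proj1 (Hg _ Hz)).
      * apply is_derive_shift_z; exact (proj1 (Hf _ Hu)).
      * exact (proj2 (Hg _ Hz)).
    + unfold plus; simpl; ring.
Qed.

Lemma curvature_equation (K : R) (y z : R) : D y z ->
  a * f' (y + a * z) * g z + f (y + a * z) * g' z <> 0 ->
  gauss_curvature w y z = K ->
  f (y + a * z) * f'' (y + a * z) * (g z * g'' z) - (f' (y + a * z) * g' z) ^ 2
  = K * (a * f' (y + a * z) * g z + f (y + a * z) * g' z) ^ 4.
Proof.
  intros Hyz Hw <-; unfold gauss_curvature.
  rewrite partial_derive_01, partial_derive_20, partial_derive_11, partial_derive_02
    by exact Hyz.
  field; exact Hw.
Qed.

End PartialDerivatives.

(** * Classification of the flat surfaces *)

Lemma factorable2_flat_cases (a : R) (l1 r1 l2 r2 : Rbar)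
    (f f' f'' g g' g'' : R -> R) :
  Rbar_lt l1 r1 -> Rbar_lt l2 r2 ->
  derivatives_on l1 r1 f f' f'' -> derivatives_on l2 r2 g g' g'' ->
  (forall u z, in_itv l1 r1 u -> in_itv l2 r2 z ->
     a * f' u * g z + f u * g' z <> 0) ->
  (forall u z, in_itv l1 r1 u -> in_itv l2 r2 z ->
     f u * f'' u * (g z * g'' z) = (f' u * g' z) ^ 2) ->
  (exists u, in_itv l1 r1 u /\ f' u <> 0) ->
  (exists c, forall u z, in_itv l1 r1 u -> in_itv l2 r2 z ->
     g z = c /\ f' u <> 0) \/
  (exists A c B d, forall u z, in_itv l1 r1 u -> in_itv l2 r2 z ->
     f u = A * exp (c * u) /\ g z = B * exp (d * z)) \/
  (exists k A p B q, k <> 1 /\ forall u z, in_itv l1 r1 u -> in_itv l2 r2 z ->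
     u - p <> 0 /\ f u = A * Rpower (Rabs (u - p)) (1 / (1 - k)) /\
     z - q <> 0 /\ g z = B * Rpower (Rabs (z - q)) (k / (k - 1))).
Proof.
  intros HI1 HI2 Hf Hg Hw HK [u0 [Hu0 Hd0]].
  destruct (classic (exists z, in_itv l2 r2 z /\ g' z <> 0)) as [[z0 [Hz0 He0]] | Hno].
  2: { left.
    assert (Hg0 : forall z, in_itv l2 r2 z -> g' z = 0).
    { intros z Hz; apply NNPP; intros E; apply Hno; now exists z. }
    destruct (in_itv_nonempty _ _ HI2) as [z0 Hz0].
    exists (g z0); intros u z Hu Hz; split.
    - apply (derive_zero_constant l2 r2 g); try assumption.
      intros x Hx; rewrite <- (Hg0 x Hx); exact (proj1 (Hg x Hx)).
    - intros E; apply (Hw u z Hu Hz); rewrite E, (Hg0 z Hz); ring. }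
  right.
  set (k := (g' z0) ^ 2 / (g z0 * g'' z0)).
  assert (H0 : f u0 * f'' u0 * (g z0 * g'' z0) <> 0).
  { rewrite HK by assumption.
    now apply pow_nonzero, Rmult_integral_contrapositive_currified. }
  assert (Hgg : g z0 * g'' z0 <> 0).
  { intros E; apply H0; rewrite E; ring. }
  assert (Hgz0 : g z0 <> 0 /\ g'' z0 <> 0).
  { split; intros E; apply Hgg; rewrite E; ring. }
  destruct Hgz0 as [Hgz0 Hgz2].
  assert (Hk0 : k <> 0).
  { unfold k, Rdiv; apply Rmult_integral_contrapositive_currified;
      [now apply pow_nonzero | now apply Rinv_neq_0_compat]. }
  assert (Hkf : forall u, in_itv l1 r1 u -> f u * f'' u = k * (f' u) ^ 2).
  { intros u Hu; apply (Rmult_eq_reg_r (g z0 * g'' z0)); [| exact Hgg].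
    rewrite HK by assumption; unfold k; field; split; assumption. }
  assert (Hkg : forall z, in_itv l2 r2 z -> g z * g'' z = / k * (g' z) ^ 2).
  { intros z Hz; apply (Rmult_eq_reg_l (k * (f' u0) ^ 2)).
    - rewrite <- Hkf at 1 by assumption; rewrite HK by assumption; field; exact Hk0.
    - apply Rmult_integral_contrapositive_currified; [exact Hk0 | now apply pow_nonzero]. }
  (* A zero of a factor would be a zero of its derivative, hence of w_z. *)
  assert (Hfn : forall u, in_itv l1 r1 u -> f u <> 0).
  { intros u Hu E; assert (H := Hkf u Hu); rewrite E, Rmult_0_l in H.
    symmetry in H; apply Rmult_integral in H; destruct H as [H | H]; [now apply Hk0 |].
    apply (Hw u z0 Hu Hz0); rewrite E.
    replace (f' u) with 0; [ring |].
    symmetry; apply NNPP; intros N; now apply (pow_nonzero (f' u) 2). }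
  assert (Hgn : forall z, in_itv l2 r2 z -> g z <> 0).
  { intros z Hz E; assert (H := Hkg z Hz); rewrite E, Rmult_0_l in H.
    symmetry in H; apply Rmult_integral in H; destruct H as [H | H];
      [now apply (Rinv_neq_0_compat k) |].
    apply (Hw u0 z Hu0 Hz); rewrite E.
    replace (g' z) with 0; [ring |].
    symmetry; apply NNPP; intros N; now apply (pow_nonzero (g' z) 2). }
  destruct (Req_dec k 1) as [Hk1 | Hk1]; [left | right].
  - destruct (exponential_of_constant_ratio l1 r1 f f' f'')
      as [A [c Hfe]]; try assumption.
    { intros u Hu; rewrite Hkf, Hk1 by exact Hu; ring. }
    destruct (exponential_of_constant_ratio l2 r2 g g' g'')
      as [B [d Hge]]; try assumption.
    { intros z Hz; rewrite Hkg, Hk1 by exact Hz; field. }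
    exists A, c, B, d; intros u z Hu Hz; split; auto.
  - destruct (power_of_constant_ratio l1 r1 f f' f'' k)
      as [A [p Hfp]]; try assumption.
    { now exists u0. }
    destruct (power_of_constant_ratio l2 r2 g g' g'' (/ k))
      as [B [q Hgq]]; try assumption.
    { now exists z0. }
    { intros E; apply Hk1; rewrite <- (Rinv_inv k), E; apply Rinv_1. }
    exists k, A, p, B, q; split; [exact Hk1 |].
    intros u z Hu Hz.
    destruct (Hfp u Hu) as [Hup Efu]; destruct (Hgq z Hz) as [Hzq Egz].
    repeat split; try assumption.
    (* The power law for the ratio [/ k] has exponent [1 / (1 - / k)]. *)
    replace (k / (k - 1)) with (1 / (1 - / k)); [exact Egz |].
    field; repeat split; lra.
Qed.

Theorem theorem4p1 (a K0 : R) (l1 r1 l2 r2 : Rbar) (f1 f2 : R -> R)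
  (ha : a <> 0)
  (hI1 : Rbar_lt l1 r1) (hI2 : Rbar_lt l2 r2)
  (hf1 : smooth_on l1 r1 f1) (hf2 : smooth_on l2 r2 f2)
  (hadm : admissible (factorable2_dom a l1 r1 l2 r2) (factorable2 a f1 f2))
  (hK : forall y z : R, factorable2_dom a l1 r1 l2 r2 y z ->
          gauss_curvature (factorable2 a f1 f2) y z = K0) :
  K0 = 0 /\
  (~ constant_on l1 r1 f1 ->
   exists c1 c2 c3 : R,
     case_one_factor a (factorable2_dom a l1 r1 l2 r2) f1 (factorable2 a f1 f2) c1 \/
     case_exponential a (factorable2_dom a l1 r1 l2 r2) (factorable2 a f1 f2) c1 c2 c3 \/
     case_power a (factorable2_dom a l1 r1 l2 r2) (factorable2 a f1 f2) c1 c2).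
Proof.
  assert (Hf := smooth_derivatives_on l1 r1 f1 hf1).
  assert (Hg := smooth_derivatives_on l2 r2 f2 hf2).
  set (f' := Derive f1) in *; set (f'' := Derive f') in *.
  set (g' := Derive f2) in *; set (g'' := Derive g') in *.
  assert (Hdom : forall u z, in_itv l1 r1 u -> in_itv l2 r2 z ->
            factorable2_dom a l1 r1 l2 r2 (u - a * z) z).
  { intros u z Hu Hz; split; [| exact Hz].
    now replace (u - a * z + a * z) with u by ring. }
  assert (Hw : forall u z, in_itv l1 r1 u -> in_itv l2 r2 z ->
            a * f' u * f2 z + f1 u * g' z <> 0).
  { intros u z Hu Hz.
    assert (H := hadm _ _ (Hdom u z Hu Hz)).
    rewrite (partial_derive_01 a l1 r1 l2 r2 f1 f' f'' f2 g' g'') in H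
      by (try assumption; now apply Hdom).
    now replace (u - a * z + a * z) with u in H by ring. }
  assert (HE : forall u z, in_itv l1 r1 u -> in_itv l2 r2 z ->
            f1 u * f'' u * (f2 z * g'' z) - (f' u * g' z) ^ 2
            = K0 * (a * f' u * f2 z + f1 u * g' z) ^ 4).
  { intros u z Hu Hz.
    assert (H := curvature_equation a l1 r1 l2 r2 f1 f' f'' f2 g' g'' Hf Hg
                   K0 _ _ (Hdom u z Hu Hz)).
    replace (u - a * z + a * z) with u in H by ring.
    apply H; [now apply Hw | now apply hK, Hdom]. }
  assert (HK0 : K0 = 0).
  { now apply (curvature_constant_zero l1 r1 l2 r2 f1 f' f'' f2 g' g'' a). }
  split; [exact HK0 |].
  intros Hnc.
  destruct (factorable2_flat_cases a l1 r1 l2 r2 f1 f' f'' f2 g' g'')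
    as [[c H] | [[A [c [B [d H]]]] | [k [A [p [B [q [Hk H]]]]]]]]; try assumption.
  - intros u z Hu Hz; apply Rminus_diag_uniq.
    rewrite HE, HK0 by assumption; ring.
  - apply NNPP; intros Hno; apply Hnc.
    destruct (in_itv_nonempty _ _ hI1) as [u0 Hu0].
    exists (f1 u0); intros u Hu.
    apply (derive_zero_constant l1 r1 f1); try assumption.
    intros x Hx; replace 0 with (f' x); [exact (proj1 (Hf x Hx)) |].
    apply NNPP; intros E; apply Hno; now exists x.
  - exists c, 0, 0; left; intros y z [Hu Hz].
    destruct (H _ _ Hu Hz) as [Eg Hd]; split.
    + unfold factorable2; rewrite Eg; ring.
    + assert (E : partial_derive 0 1 (fun y' z' => f1 (y' + a * z')) y z
                  = a * f' (y + a * z)).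
      { apply is_derive_unique, is_derive_shift_z; exact (proj1 (Hf _ Hu)). }
      rewrite E.
      now apply Rmult_integral_contrapositive_currified.
  - exists (A * B), c, d; right; left; intros y z [Hu Hz].
    destruct (H _ _ Hu Hz) as [Ef Eg]; unfold factorable2.
    rewrite Ef, Eg, exp_plus; ring.
  - exists (A * B), k, 0; right; right; split; [exact Hk |].
    (* y0 is chosen so that (y - y0) + a (z - z0) = u - p. *)
    exists (p - a * q), q; intros y z [Hu Hz].
    destruct (H _ _ Hu Hz) as [Hup [Ef [Hzq Eg]]].
    replace (y - (p - a * q) + a * (z - q)) with (y + a * z - p) by ring.
    repeat split; try assumption.
    unfold factorable2; rewrite Ef, Eg; ring.
Qed.
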